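(* Let $X$ be a regular space. Then Bob has a winning strategy in $\mathsf{G}_{\mathrm{bnd}}(\mathcal{O},\mathcal{O})$ over $X$ if, and only if, there is a compact set $K\subset X$ such that, for every open set $V\supset K$, Bob has a winning strategy in $\mathsf{G}_1(\mathcal{O},\mathcal{O})$ over the subspace $X\setminus V$.
   Context: Here $\omega=\{0,1,2,\dots\}$. $\mathcal{O}$ denotes the set of open covers of the space under consideration; a game ''over $Y$'' is the game with $\mathcal{O}$ the set of open covers of $Y$ (with the subspace topology if $Y\subset X$). The following games are played between Alice and Bob, with innings $n\in\omega$; in each inning $n$ Alice first chooses $A_n\in\mathcal{O}$ and then Bob responds with a finite $B_n\subset A_n$, each player knowing all previous moves. In $\mathsf{G}_1(\mathcal{O},\mathcal{O})$, Bob must choose $|B_n|\le 1$ in every inning, and Bob wins if $\bigcup_{n\in\omega}B_n\in\mathcal{O}$; otherwise Alice wins. In $\mathsf{G}_{\mathrm{bnd}}(\mathcal{O},\mathcal{O})$, Bob wins if $\bigcup_{n\in\omega}B_n\in\mathcal{O}$ and there is a $k\in\omega$ such that $|B_n|\le k$ for every $n\in\omega$; otherwise Alice wins. *)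

(* Defs.v *)
From mathcomp Require Import all_boot all_classical.
From mathcomp Require Export topology.

Set Implicit Arguments.
Unset Strict Implicit.
Unset Printing Implicit Defensive.

Local Open Scope classical_set_scope.
Local Open Scope card_scope.

Definition open_cover (T : topologicalType) (U : set (set T)) : Prop :=
  U `<=` open /\ \bigcup_(u in U) u = [set: T].

(* Bob's own earlier moves are determined by his strategy and Alice's earlier
   moves, so a strategy only takes Alice's moves [:: A_0; ...; A_n], in
   chronological order; its value on the empty sequence is irrelevant. *)
Definition bob_strategy (T : topologicalType) : Type :=
  seq (set (set T)) -> set (set T).

Definition bob_answers (T : topologicalType) (sigma : bob_strategy T)
    (A : nat -> set (set T)) (n : nat) : set (set T) :=
  sigma (mkseq A n.+1).

(* [won] is the part of the rules and of the winning condition that is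
   specific to the game; it only depends on the sequence of Bob's moves. *)
Definition winning_for_bob (T : topologicalType)
    (won : (nat -> set (set T)) -> Prop) (sigma : bob_strategy T) : Prop :=
  forall A : nat -> set (set T), (forall n, open_cover (A n)) ->
    (forall n, finite_set (bob_answers sigma A n) /\
               bob_answers sigma A n `<=` A n) /\
    won (bob_answers sigma A).

Definition won_G1 (T : topologicalType) (B : nat -> set (set T)) : Prop :=
  (forall n, B n #<= `I_1) /\ open_cover (\bigcup_n B n).

Definition won_Gbnd (T : topologicalType) (B : nat -> set (set T)) : Prop :=
  open_cover (\bigcup_n B n) /\ exists k, forall n, B n #<= `I_k.

Definition bob_wins_G1 (T : topologicalType) : Prop :=
  exists sigma : bob_strategy T, winning_for_bob (@won_G1 T) sigma.

Definition bob_wins_Gbnd (T : topologicalType) : Prop :=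
  exists sigma : bob_strategy T, winning_for_bob (@won_Gbnd T) sigma.

(* Main.v *)
Require Import Defs.
From mathcomp Require Import all_boot all_classical topology.

(** If [K] is compact and Bob wins the one-set game off every neighbourhood of
    [K], he answers Alice's first cover with a finite subfamily covering [K];
    what is left to cover is the complement of an open set [V] containing [K],
    and from then on he follows his one-set strategy there.  The number of sets
    he plays per inning is bounded by the size of that first answer.

    Conversely, let [sigma] be winning for Bob in the bounded game.  Then [X] is
    Lindelof (let Alice repeat one cover forever).  Call an open set boundedly
    coverable if, for some [k], it gets covered by a strategy that produces [k]
    sets per inning, each inside a member of Alice's cover.  The compact set is
    [uncoverable X], the set of points without a boundedly coverable
    neighbourhood.

    It is compact ([compact_uncoverable]).  Let [F] be a proper filter on it
    without cluster point in it, and let Alice only use covers finer than the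
    family of open sets whose closure is disjoint from a member of [F]; this
    family is a cover by regularity.  Alice cannot force Bob to play more and
    more sets forever, since [sigma] wins; so there are a position [s] and a [k]
    such that after [s] Bob never uses more than [k] sets
    ([bounded_position]).  The finitely many sets played up to [s] have a union
    whose closure still misses a member of [F], hence misses a point of
    [uncoverable X].  But the complement of that closure is boundedly coverable,
    by continuing [sigma] from [s] ([boundedly_coverable_position]): a
    contradiction.

    Bob wins the one-set game off any open [V] containing [uncoverable X].  By
    the Lindelof property countably many strategies, the [j]-th one with bound
    [k j], cover the complement of [V].  After the history [s] in strategy [j],
    consider the set [core j s] of points that are in the closure of the next
    reply for every next cover of Alice.  In a regular space [core j s] has at
    most [k j] points up to topological indistinguishability
    ([separated_not_in_small_closures]), so playing finitely many sets around
    its points outside [V] swallows it.  Once this is done, the Lindelof property gives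
    countably many covers such that each point not yet covered lies outside the
    closure of the reply to one of them.  Branching over these covers, Bob visits
    all nodes of a countable tree, one per inning ([bob_wins_G1_of_tree]).  A
    point that he never covers would determine a branch of the tree along which
    Alice defeats the [j]-th strategy. *)

Set Implicit Arguments.
Unset Strict Implicit.
Unset Printing Implicit Defensive.

Local Open Scope classical_set_scope.
Local Open Scope card_scope.

(** * Infinite plays as limits of growing positions *)

(** Dependent choice on finite sequences: [p n] is the length of the [n]-th of the
    growing positions whose limit is [A]. *)
Lemma sequence_of_extensions (T : Type) (x0 : T) (R : seq T -> Prop)
    (Q : seq T -> seq T -> Prop) : R [::] ->
    (forall s, R s -> exists2 t, t <> [::] & R (s ++ t) /\ Q s (s ++ t)) ->
  exists (A : nat -> T) (p : nat -> nat), p 0 = 0 /\ forall n, p n < p n.+1 /\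
    R (mkseq A (p n)) /\ Q (mkseq A (p n)) (mkseq A (p n.+1)).
Proof.
move=> R0 RQ; pose S := {s : seq T | R s}.
have next (s : S) : {s' : S | exists2 t, t <> [::] &
    sval s' = sval s ++ t /\ Q (sval s) (sval s')}.
  case: s => s Rs; apply: cid; have [t t0 [Rst Qst]] := RQ s Rs.
  by exists (exist _ _ Rst), t.
have [f [f0 fS]] := dependent_choice next (exist _ _ R0).
pose s n := sval (f n).
have sS n : exists2 t, t <> [::] & s n.+1 = s n ++ t /\ Q (s n) (s n.+1).
  exact: fS.
have sizeS n : size (s n) < size (s n.+1).
  have [t t0 [-> _]] := sS n; rewrite size_cat -[X in X < _]addn0 ltn_add2l.
  by case: t t0.
have size_ge n : n <= size (s n).
  by elim: n => // n IH; apply: leq_ltn_trans IH (sizeS n).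
have prefix_s m n : m <= n -> s m = take (size (s m)) (s n).
  move/subnK <-; elim: (n - m) => [|d IH]; first by rewrite take_size.
  have [t _ [-> _]] := sS (d + m).
  rewrite takel_cat // [X in size X]IH size_take_min geq_minr //.
pose A m := nth x0 (s m.+1) m.
have sE n : s n = mkseq A (size (s n)).
  apply: (@eq_from_nth _ x0); rewrite ?size_mkseq// => i ltis.
  rewrite nth_mkseq // /A; have [/prefix_s ->|/ltnW/prefix_s E] := leqP n i.+1.
    by rewrite nth_take.
  by rewrite [X in _ = nth _ X _]E nth_take.
exists A, (fun n => size (s n)); split; first by rewrite /s f0.
move=> n; rewrite -!sE; split; [exact: sizeS | split; first exact: svalP].
by have [t _ []] := sS n.
Qed.

Lemma sequence_of_rcons (T : Type) (x0 : T) (R : seq T -> Prop) : R [::] ->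
  (forall s, R s -> exists a, R (rcons s a)) ->
  exists A : nat -> T, forall n, R (mkseq A n).
Proof.
move=> R0 RS.
have [|A [p [p0 pP]]] := @sequence_of_extensions _ x0 R
    (fun s s' => size s' = (size s).+1) R0.
  move=> s /RS [a Ra]; exists [:: a] => //.
  by rewrite cats1 size_rcons.
exists A => n; have pn : p n = n.
  elim: n => // n IH; have [_ [_]] := pP n.
  by rewrite !size_mkseq IH.
by have [_ []] := pP n; rewrite pn.
Qed.

(** * Strategies indexed by the tree of finite sequences *)

Section tree_strategy.
Variables (Y : topologicalType) (S : Type) (s0 : S) (pt : S -> Y).
Variable step : S -> set Y -> nat -> S.

(** Positions are written with the most recent branch first, so that the suffixes
    of [t] are its ancestors in the tree. *)
Fixpoint node (V : seq nat -> set Y) (t : seq nat) : S :=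
  if t is i :: t' then step (node V t') (V t') i else s0.

Let pick (A : set (set Y)) (y : Y) : set Y :=
  xget set0 [set U | A U /\ U y].

Let pickP A y : open_cover A -> A (pick A y) /\ pick A y y.
Proof.
move=> [_ Acov]; rewrite /pick.
have [U AU Uy] : (\bigcup_(u in A) u) y by rewrite Acov.
by case: xgetP => [V _ //|/(_ U)[]].
Qed.

Let play (A : nat -> set (set Y)) := fix play (t : seq nat) : S :=
  if t is i :: t' then
    step (play t') (pick (A (CodeSeq.code t')) (pt (play t'))) i
  else s0.

Let code_cons i t : CodeSeq.code t < CodeSeq.code (i :: t).
Proof.
rewrite /= -[X in X < _]mul1n; set m := CodeSeq.code t.
apply: (@leq_trans (2 ^ i * m.+1)).
  by rewrite mulnS -[X in X < _]add0n -addSn leq_add ?expn_gt0// leq_mul ?expn_gt0.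
by rewrite leq_mul2l ltnS -addnn leq_addr orbT.
Qed.

Let eq_play A A' t : (forall m, m < CodeSeq.code t -> A m = A' m) ->
  play A t = play A' t.
Proof.
elim: t => //= i t IH eqA; have lt_t := code_cons i t.
rewrite IH ?eqA// => m mt; apply: eqA; exact: ltn_trans mt lt_t.
Qed.

(** The point-open form of the one-set game, played on all nodes of a countably
    branching tree at once: at node [t] Bob names a point depending only on what
    happened at the ancestors of [t], and Alice answers with a neighbourhood.
    Goedel numbers of sequences increase from a node to its children, so Bob can
    treat the node with number [n] in inning [n]: the data that he needs about its
    ancestors is already there.  He picks a member of Alice's cover around the
    point of that node. *)
Lemma bob_wins_G1_of_tree :
  (forall V : seq nat -> set Y, (forall t, open (V t)) ->
    (forall t, V t (pt (node V t))) -> forall y, exists t, V t y) ->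
  bob_wins_G1 Y.
Proof.
move=> win.
pose sigma (l : seq (set (set Y))) : set (set Y) :=
  let n := (size l).-1 in
  let A := nth set0 l in
  [set pick (A n) (pt (play A (CodeSeq.decode n)))].
exists sigma => A Acov.
pose V t := pick (A (CodeSeq.code t)) (pt (play A t)).
have nodeE t : node V t = play A t by elim: t => //= i t ->.
have ansE n : bob_answers sigma A n = [set V (CodeSeq.decode n)].
  rewrite /bob_answers /sigma size_mkseq /= nth_mkseq// /V CodeSeq.decodeK.
  congr [set pick _ (pt _)]; apply: eq_play => m; rewrite CodeSeq.decodeK => mn.
  by rewrite nth_mkseq // ltnS ltnW.
have Vin n : A n (V (CodeSeq.decode n)).
  have [+ _] := pickP (pt (play A (CodeSeq.decode n))) (Acov n).
  by rewrite /V CodeSeq.decodeK.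
have Vopen t : open (V t).
  by apply: (Acov (CodeSeq.code t)).1; rewrite -{2}(CodeSeq.codeK t).
split=> [n|].
  by rewrite ansE; split; [exact: finite_set1 | move=> _ ->].
split=> [n|]; first by rewrite ansE; have /card_eqPle[] := @card_set1 _ (V (CodeSeq.decode n)).
split=> [U [n _]|]; first by rewrite ansE => ->.
apply/seteqP; split=> // y _.
have [t|t Vty] := win V Vopen _ y.
  by rewrite nodeE; exact: (pickP _ (Acov _)).2.
exists (V t) => //; exists (CodeSeq.code t) => //.
by rewrite ansE CodeSeq.codeK.
Qed.

End tree_strategy.

(** * Closures of small unions in regular spaces *)

Lemma closure_bigcup_finite (X : topologicalType) (I : choiceType) (D : set I)
    (B : I -> set X) : finite_set D ->
  closure (\bigcup_(i in D) B i) `<=` \bigcup_(i in D) closure (B i).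
Proof.
move=> finD; have cl : closed (\bigcup_(i in D) closure (B i)).
  by apply: closed_bigcup => // i _; exact: closed_closure.
rewrite [X in _ `<=` X](closure_id _).1//; apply: closureS => x [i Di Bx].
by exists i => //; exact: subset_closure.
Qed.

Section regular.
Variables (X : topologicalType).
Hypothesis regX : @regular_space X.

Lemma regular_open_closure (U : set X) x : open U -> U x ->
  exists N : set X, [/\ open N, N x & closure N `<=` U].
Proof.
move=> oU Ux; have [|B Bx BU] := @regX x U; first exact: open_nbhs_nbhs.
exists (B°); split => //; first exact: open_interior.
exact: subset_trans (closureS (@interior_subset _ B)) BU.
Qed.

(** The family of open sets whose closure does not contain both [q] and [q'] is a
    cover.  If [x] is close to [q], a neighbourhood of [q] whose closure stays in
    [P] is one of [x]; otherwise [x] has a neighbourhood whose closure avoids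
    [q]. *)
Lemma regular_separate (P : set X) q q' x : open P -> P q -> ~ P q' ->
  exists N : set X, [/\ open N, N x & ~ (closure N q /\ closure N q')].
Proof.
move=> oP Pq Pq'; have [N [oN Nq NP]] := regular_open_closure oP Pq.
have [N' [oN' N'q N'N]] := regular_open_closure oN Nq.
have [cx|cx] := pselect (closure N' x).
  exists N; split; [by []|exact: N'N|by case=> _ /NP].
exists (~` closure N'); split => //; first by rewrite openC; exact: closed_closure.
move=> [cq _]; have [|y [cy Ny]] := cq N'; last exact/cy/subset_closure.
exact: open_nbhs_nbhs.
Qed.

(** The increasing open sets [P n] make the points [q n] pairwise topologically
    distinguishable.  If the closure of each member of [A] contains at most one of
    [q 0], ..., [q k], a union of [k] sets finer than [A] misses one of these [k + 1]
    points in its closure, by the pigeonhole principle. *)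
Lemma separated_not_in_small_closures (k : nat) (q : nat -> X) (P : nat -> set X) :
  (forall n, open (P n)) -> (forall n, P n `<=` P n.+1) ->
  (forall n, P n.+1 (q n)) -> (forall n, ~ P n (q n)) ->
  exists A : set (set X), open_cover A /\
    forall B : nat -> set X,
      (forall i, i < k -> exists2 U, A U & B i `<=` U) ->
      exists a, ~ closure (\bigcup_(i in `I_k) B i) (q a).
Proof.
move=> oP Pinc Pq PNq.
have Ple m n : m <= n -> P m `<=` P n.
  by move=> /subnK <-; elim: (n - m) => // d IH; apply: subset_trans IH (Pinc _).
have sep a b x : a < b ->
    exists N, [/\ open N, N x & ~ (closure N (q a) /\ closure N (q b))].
  by move=> ab; apply: regular_separate (oP b) _ (PNq b); exact: Ple (Pq a).
pose A : set (set X) := [set O | open O /\ forall a b : 'I_k.+1,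
  a < b -> ~ (closure O (q a) /\ closure O (q b))].
exists A; split.
  split=> [O [] //|]; apply/seteqP; split=> // x _.
  have Nx (ab : 'I_k.+1 * 'I_k.+1) : {N : set X | [/\ open N, N x &
      ab.1 < ab.2 -> ~ (closure N (q ab.1) /\ closure N (q ab.2))]}.
    apply: cid; have [lt|ge] := ltnP ab.1 ab.2.
      by have [N [oN Nx NN]] := sep _ _ x lt; exists N.
    exists setT; split; [exact: openT|by []|by []].
  pose O : set X := (\bigcap_ab sval (Nx ab))°.
  have near_x : nbhs x (\bigcap_ab sval (Nx ab)).
    have : \forall y \near x, forall ab, sval (Nx ab) y.
      apply: filter_forall => ab; case: (Nx ab) => N /= [oN Nx' _].
      exact: open_nbhs_nbhs.
    by apply: filterS => y Ny ab _; exact: Ny.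
  exists O; last exact: near_x.
  split; first exact: open_interior.
  move=> a b ab; have [_ _ /(_ ab)] := svalP (Nx (a, b)).
  have ON : O `<=` sval (Nx (a, b)).
    by apply: subset_trans (@interior_subset _ _) _ => y; exact.
  by move=> NN [/(closureS ON) ? /(closureS ON) ?]; exact: NN.
move=> B BA; apply: contrapT => /forallNP qB.
have {}qB a : {i | i < k & closure (B i) (q a)}.
  by apply: cid2; have /contrapT/closure_bigcup_finite[|i ik qi] := qB a; [|exists i].
pose f a := s2val (qB a).
suff : k.+1 <= k by rewrite ltnn.
apply: (@pigeonhole _ _ f); last by move=> _ [a _ <-]; exact: (s2valP (qB a)).
suff lt a b : a < b -> b < k.+1 -> f a <> f b.
  move=> a b; rewrite !inE /= => ak bk fab; have [ab|ba|//] := ltngtP a b.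
    by case: (lt a b).
  by case: (lt b a).
move=> ab bk fab; have ak := ltn_trans ab bk.
have [U [_ /(_ (Ordinal ak) (Ordinal bk) ab) UN] BU] := BA _ (s2valP (qB a)).
apply: UN; split; apply: (closureS BU); first exact: (s2valP' (qB a)).
by rewrite -/(f a) fab; exact: (s2valP' (qB b)).
Qed.

End regular.

(** * The Lindelof property *)

Lemma enum_of_card_le (T : Type) (x0 : T) (D : set nat) (B : set T) :
  B #<= D -> exists f : nat -> T,
    (forall i, D i -> B (f i) \/ f i = x0) /\
    forall b, B b -> exists2 i, D i & f i = b.
Proof.
case/pfcard_geP => [->|[f]]; first by exists (fun=> x0); split => // i; right.
exists f; split; last by move=> b Bb; have [i Di fib] := 'surj_f Bb; exists i.
by move=> i Di; left; exact: funS.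
Qed.

Definition lindelof (X : topologicalType) : Prop :=
  forall A : set (set X), open_cover A ->
    exists B : set (set X), [/\ B `<=` A, countable B & \bigcup_(U in B) U = setT].

Lemma lindelof_of_bob_wins_Gbnd (X : topologicalType) :
  bob_wins_Gbnd X -> lindelof X.
Proof.
move=> [sigma win] A Acov; have [ans [[_ cov] _]] := win (fun=> A) (fun=> Acov).
exists (\bigcup_n bob_answers sigma (fun=> A) n); split=> //.
  by move=> U [n _]; exact: (ans n).2.
by apply: bigcup_countable => // n _; apply: finite_set_countable; exact: (ans n).1.
Qed.

Lemma lindelof_sequence (X : topologicalType) (A : set (set X)) : lindelof X ->
  X -> open_cover A -> exists f : nat -> set X,
    (forall n, A (f n)) /\ forall x, exists n, f n x.
Proof.
move=> lin x0 Acov; have [B [BA Bc Bcov]] := lin A Acov.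
have BP x : exists2 U, B U & U x.
  by have : (\bigcup_(U in B) U) x by rewrite Bcov.
have [U0 BU0 _] := BP x0.
have [f [fB Bf]] := @enum_of_card_le _ U0 setT B Bc.
exists f; split=> [n|x]; first by apply: BA; case: (fB n I) => // ->.
by have [U /Bf[n _ <-] Ux] := BP x; exists n.
Qed.

(** * Boundedly coverable sets *)

(** A [k]-set strategy that only has to cover [O].  Its replies refine the cover
    played by Alice instead of being members of it; this keeps the notion stable
    when Alice's covers are replaced by finer ones. *)
Definition bounded_strategy_on (X : topologicalType) (O : set X) (k : nat)
    (tau : seq (set (set X)) -> nat -> set X) : Prop :=
  (forall s A, (forall A', A' \in s -> open_cover A') -> open_cover A ->
     forall i, i < k -> exists2 U, A U & tau (rcons s A) i `<=` U) /\
  forall A, (forall n, open_cover (A n)) ->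
    O `<=` \bigcup_n \bigcup_(i in `I_k) tau (mkseq A n.+1) i.

Definition boundedly_coverable (X : topologicalType) (O : set X) : Prop :=
  exists k tau, @bounded_strategy_on X O k tau.

Lemma open_cover_setT (X : topologicalType) : open_cover [set [set: X]].
Proof.
by split=> [_ ->|]; [exact: openT | rewrite bigcup_set1].
Qed.

Lemma bob_wins_G1_empty (Y : topologicalType) : (Y -> False) -> bob_wins_G1 Y.
Proof.
move=> Y0; exists (fun=> set0) => A Acov; split=> [n|]; first by split.
split=> [n|]; first exact: card_ge0.
by split=> [U [] //|]; apply/seteqP; split=> // y; case: (Y0 y).
Qed.

(** Turns the sets that Bob plays in the subspace into open sets of [X], where the
    closures of the replies are taken. *)
Lemma open_setU_image (X : topologicalType) (V : set X)
    (u : set (set_type (~` V))) : open V -> open u -> open (V `|` set_val @` u).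
Proof.
move=> oV [G oG <-].
suff -> : V `|` (set_val @` (set_val @^-1` G : set (set_type (~` V)))) = V `|` G.
  exact: openU.
apply/seteqP; split=> x [Vx|]; try by left.
  by move=> [y Gy <-]; right.
have [|Vx] := pselect (V x); first by left.
by right; exists (SigSub (mem_set (Vx : (~` V) x))).
Qed.

(** * From bounded strategies to the one-set game *)

Section tree_of_positions.
Variables (X : topologicalType) (V : set X).
Hypotheses (regX : @regular_space X) (linX : lindelof X) (oV : open V).
Hypothesis locX : forall x, ~ V x ->
  exists O : set X, [/\ open O, O x & boundedly_coverable O].

Let Y := set_type (~` V).

Lemma countably_many_strategies : X ->
  exists (k : nat -> nat) (tau : nat -> seq (set (set X)) -> nat -> set X),
  forall x, ~ V x -> exists j, exists2 O : set X, O x &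
    @bounded_strategy_on X O (k j) (tau j).
Proof.
move=> x0.
have [|f [fA fcov]] := @lindelof_sequence X
    [set O | open O /\ (O `<=` V \/ boundedly_coverable O)] linX x0.
  split=> [O []//|]; apply/seteqP; split=> // x _.
  have [Vx|/locX[O [oO Ox bO]]] := pselect (V x).
    by exists V => //; split=> //; left.
  by exists O => //; split=> //; right.
have kt n : {kt : nat * (seq (set (set X)) -> nat -> set X) |
    f n `<=` V \/ bounded_strategy_on (f n) kt.1 kt.2}.
  apply: cid; have [_ [fV|[k [tau b]]]] := fA n.
    by exists (0, fun _ _ => set0); left.
  by exists (k, tau); right.
exists (fun n => (sval (kt n)).1), (fun n => (sval (kt n)).2) => x Vx.
have [n fnx] := fcov x; exists n; exists (f n) => //.
by case: (svalP (kt n)) => // /(_ _ fnx).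
Qed.

Variables (k : nat -> nat) (tau : nat -> seq (set (set X)) -> nat -> set X).
Variable y0 : Y.

Let reply j s : set X := \bigcup_(i in `I_(k j)) tau j s i.
Let core j s : set X :=
  [set x | forall A, open_cover A -> closure (reply j (rcons s A)) x].

Let lift (u : set Y) : set X := V `|` set_val @` u.

Let lift_open u : open u -> open (lift u).
Proof. exact: open_setU_image. Qed.

(** Once [V `|` P] is open and contains the core, the replies to all possible next
    covers have no common closure point outside it; by the Lindelof property countably many next covers suffice to
    witness this. *)
Let countably_many_covers j s (P : set X) : exists E : nat -> set (set X),
  (forall i, open_cover (E i)) /\
  (open P -> core j s `<=` V `|` P -> forall x, ~ V x -> ~ P x ->
    exists i, ~ closure (reply j (rcons s (E i))) x).
Proof.
have [oP|nP] := pselect (open P); last first.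
  by exists (fun=> [set setT]); split=> // _; exact: open_cover_setT.
have [KP|nKP] := pselect (core j s `<=` V `|` P); last first.
  by exists (fun=> [set setT]); split=> // _; exact: open_cover_setT.
pose bad A : set X := ~` closure (reply j (rcons s A)).
have [|f [fA fcov]] := @lindelof_sequence X
   [set O | O = V `|` P \/ exists2 A, open_cover A & O = bad A] linX (set_val y0).
  split=> [O [->|[A _ ->]]|]; first exact: openU.
    by rewrite openC; exact: closed_closure.
  apply/seteqP; split=> // x _.
  have [VPx|VPx] := pselect ((V `|` P) x); first by exists (V `|` P) => //; left.
  have /existsNP[A /not_implyP[Acov nA]] : ~ core j s x by move=> /KP.
  by exists (bad A) => //; right; exists A.
have E n : {A | open_cover A & f n `<=` V `|` P \/ f n = bad A}.
  apply: cid2; have [->|[A Ac ->]] := fA n.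
    by exists [set setT]; [exact: open_cover_setT | left].
  by exists A => //; right.
exists (fun n => s2val (E n)); split=> [i|_ _ x Vx Px]; first exact: s2valP.
have [n fnx] := fcov x; exists n.
case: (s2valP' (E n)) => [/(_ _ fnx)[]//|fE].
by move: fnx; rewrite {1}fE.
Qed.

Let E j s P := sval (cid (countably_many_covers j s P)).

(** [Some (j, s, P)]: strategy [j] is followed, [s] is the history of a play against
    it, and [P] is the union of the sets played while trying to swallow
    [core j s].  [None] is the root, whose children choose [j]. *)
Let state := option (nat * seq (set (set X)) * set X).

Let pt (st : state) : Y :=
  if st is Some (j, s, P) then
    xget y0 [set y | core j s (set_val y) /\ ~ P (set_val y)]
  else y0.

(** Child [0] goes on swallowing the core; child [m.+1] extends the history by the
    [m]-th cover that becomes relevant once the core is swallowed. *)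
Let step (st : state) (u : set Y) (i : nat) : state :=
  if st is Some (j, s, P) then
    let P' := P `|` lift u in
    Some (if i is m.+1 then (j, rcons s (E j s P' m), set0) else (j, s, P'))
  else Some (i, [::], set0).

(** Along the branch of zeros above [t], the points named by Bob lie in the core and
    outside what was played before; such points are pairwise distinguishable, so
    this stops after finitely many steps.  Then the core is swallowed, and an
    uncovered point [x] escapes the reply to one of the countably many relevant
    covers, which gives the node [t']. *)
Let advance U j s t x (O : set X) :
  (forall t, open (U t)) ->
  (forall t, U t (pt (node None step U t))) ->
  (forall t, ~ lift (U t) x) ->
  bounded_strategy_on O (k j) (tau j) ->
  (forall A, A \in s -> open_cover A) ->
  node None step U t = Some (j, s, set0) ->
  exists A t', [/\ open_cover A, node None step U t' = Some (j, rcons s A, set0)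
    & ~ reply j (rcons s A) x].
Proof.
move=> oU Upt Ux [tauA _] scov nodet.
(* The union of the sets played at the first [n] nodes of the branch of zeros. *)
pose P := fix P n := if n is n'.+1 then P n' `|` lift (U (nseq n' 0 ++ t)) else set0.
have nodeP n : node None step U (nseq n 0 ++ t) = Some (j, s, P n).
  by elim: n => //= n ->.
have oP n : open (P n).
  by elim: n => [|n IH]; [exact: open0 | apply: openU => //; exact: lift_open].
have Px n : ~ P n x by elim: n => [//|n IH [/IH//|/Ux]].
pose q n : Y := pt (Some (j, s, P n)).
have [n nq] : exists n, ~ (core j s (set_val (q n)) /\ ~ P n (set_val (q n))).
  apply/existsNP => Kq.
  have [|||A [Acov AB]] := @separated_not_in_small_closures X regX (k j)
      (fun n => set_val (q n)) P oP.
  - by move=> n z Pz; left.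
  - move=> n; right; right; exists (q n) => //.
    by have := Upt (nseq n 0 ++ t); rewrite nodeP.
  - by move=> n; have [] := Kq n.
  have [a] := AB (tau j (rcons s A)) (tauA s A scov Acov).
  by apply; have [+ _] := Kq a; apply.
have coreP : core j s `<=` V `|` P n.+1.
  move=> z Kz; have [Vz|Vz] := pselect (V z); [by left | right; left].
  apply: contrapT => Pz; move: nq; rewrite /q /pt /=.
  case: xgetP => [y _ //|/(_ (SigSub (mem_set (Vz : (~` V) z))))].
  by case.
have [Ecov /(_ (oP _) coreP x)] := svalP (cid (countably_many_covers j s (P n.+1))).
have Vx : ~ V x by move=> Vx; apply: (Ux t); left.
move=> /(_ Vx (Px _))[i nx]; exists (E j s (P n.+1) i), (i.+1 :: nseq n 0 ++ t).
split; [exact: Ecov | by rewrite /= nodeP |].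
by move=> /subset_closure.
Qed.

(** Iterating [advance] from an uncovered point yields a play against the strategy
    responsible for this point in which the point is never covered. *)
Lemma bob_wins_G1_of_strategies :
  (forall x, ~ V x -> exists j, exists2 O : set X, O x &
    @bounded_strategy_on X O (k j) (tau j)) ->
  bob_wins_G1 Y.
Proof.
move=> strat; apply: (@bob_wins_G1_of_tree Y state None pt step) => U oU Upt y.
apply: contrapT => /forallNP Uy; set x := set_val y.
have Vx : ~ V x by exact: (set_valP y).
have [j [O Ox bO]] := strat x Vx.
have Ux t : ~ lift (U t) x.
  move=> [//|[z Uz zx]]; apply: (Uy t).
  by rewrite (_ : y = z) //; apply: val_inj; rewrite -!set_valE.
have [|s [scov [t nodet] _]|A Ainf] := @sequence_of_rcons _ set0 (fun s =>
    [/\ forall A, A \in s -> open_cover A,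
        exists t, node None step U t = Some (j, s, set0)
      & s <> [::] -> ~ reply j s x]).
- by split=> //; exists [:: j].
- have [A [t' [Acov nodet' nx]]] := advance oU Upt Ux bO scov nodet.
  exists A; split=> [A'||_]; [|by exists t'|exact: nx].
  by rewrite mem_rcons inE => /predU1P[->//|]; exact: scov.
have Acov n : open_cover (A n).
  have [+ _ _] := Ainf n.+1; apply.
  by apply: map_f; rewrite mem_iota add0n ltnSn.
have [n _ nx] := bO.2 A Acov x Ox.
by have [_ _] := Ainf n.+1; apply.
Qed.

End tree_of_positions.

Lemma bob_wins_G1_of_locally_boundedly_coverable (X : topologicalType) (V : set X) :
  @regular_space X -> lindelof X -> open V ->
  (forall x, ~ V x -> exists O : set X, [/\ open O, O x & boundedly_coverable O]) ->
  bob_wins_G1 (set_type (~` V)).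
Proof.
move=> regX linX oV locX.
have [[y0]|noY] := pselect (inhabited (set_type (~` V))); last first.
  by apply: bob_wins_G1_empty => y; apply: noY.
have [k [tau strat]] := countably_many_strategies linX oV locX (set_val y0).
exact: bob_wins_G1_of_strategies strat.
Qed.

(** * Positions after which Bob's answers are uniformly bounded *)

Definition refines (X : Type) (A W : set (set X)) : Prop :=
  forall O, A O -> exists2 U, W U & O `<=` U.

Definition common_refinement (X : topologicalType) (W A : set (set X)) :
    set (set X) :=
  [set O | [/\ open O, exists2 U, W U & O `<=` U & exists2 U, A U & O `<=` U]].

Lemma open_cover_common_refinement (X : topologicalType) (W A : set (set X)) :
  open_cover W -> open_cover A -> open_cover (common_refinement W A).
Proof.
move=> [oW covW] [oA covA]; split=> [O []//|]; apply/seteqP; split=> // x _.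
have [U WU Ux] : (\bigcup_(U in W) U) x by rewrite covW.
have [U' AU' U'x] : (\bigcup_(U in A) U) x by rewrite covA.
exists (U `&` U') => //; split.
- by apply: openI; [exact: oW | exact: oA].
- by exists U => // y [].
- by exists U' => // y [].
Qed.

Section positions.
Variables (X : topologicalType) (sigma : bob_strategy X).
Hypothesis winning : winning_for_bob (@won_Gbnd X) sigma.

(** A winning strategy only constrains infinite plays; repeating the last cover
    forever turns a finite legal position into one. *)
Lemma answer_legal s A : (forall A', A' \in s -> open_cover A') ->
  open_cover A -> finite_set (sigma (rcons s A)) /\ sigma (rcons s A) `<=` A.
Proof.
move=> scov Acov; pose A' n := nth A s n.
have [|+ _] := @winning A'.
  move=> n; rewrite /A'; have [lt|ge] := ltnP n (size s); last by rewrite nth_default.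
  by apply: scov; exact: mem_nth.
move=> /(_ (size s)); rewrite /bob_answers mkseqS /A' nth_default //.
by rewrite mkseq_nth.
Qed.

Variable W : set (set X).
Hypothesis Wcov : open_cover W.

Definition small_position (s : seq (set (set X))) :=
  forall A, A \in s -> open_cover A /\ refines A W.

(** Otherwise Alice could extend any position so as to force an answer with more
    sets than the length of that position, again and again: in the resulting play
    Bob's answers are unbounded. *)
Lemma bounded_position : exists s k, small_position s /\
  forall t, t <> [::] -> small_position t -> sigma (s ++ t) #<= `I_k.
Proof.
apply: contrapT => unbounded.
have [|s ss|A [p [_ pP]]] := @sequence_of_extensions _ set0 small_position
    (fun s s' => ~ (sigma s' #<= `I_(size s))).
- by [].
- apply: contrapT => nt; apply: unbounded; exists s, (size s); split=> // t t0 st.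
  apply: contrapT => big; apply: nt; exists t => //; split=> //.
  by move=> A; rewrite mem_cat => /orP[/ss|/st].
have p_ge n : n <= p n.
  by elim: n => // n IH; apply: leq_ltn_trans IH (pP n).1.
have Acov n : open_cover (A n).
  have [_ [/(_ (A n)) + _]] := pP n.+1; case=> //.
  by apply: map_f; rewrite mem_iota add0n (leq_trans (p_ge n.+1)) ?leqnn.

have [_ [_ [k bound]]] := winning Acov.
have [lt [_]] := pP k; apply; rewrite size_mkseq.
have -> : p k.+1 = (p k.+1).-1.+1 by rewrite prednK // (leq_ltn_trans _ lt).
by apply: card_le_trans (bound _) _; rewrite card_le_II.
Qed.

Definition covered_at (s : seq (set (set X))) : set X :=
  \bigcup_(n in `I_(size s)) \bigcup_(U in sigma (take n.+1 s)) U.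

(** Alice's covers are replaced by their common refinements with [W] and passed to
    [sigma], played on from [s].  This gives a small continuation of [s], so the
    bound [k] applies to every answer. *)
Lemma boundedly_coverable_position s k : X -> small_position s ->
  (forall t, t <> [::] -> small_position t -> sigma (s ++ t) #<= `I_k) ->
  boundedly_coverable (~` covered_at s).
Proof.
move=> x0 ss bound; pose ref := common_refinement W.
(* Lists an answer with at most [k] sets, padded with empty sets up to [k]. *)
have en (B : set (set X)) : {f : nat -> set X | B #<= `I_k ->
    (forall i, i < k -> B (f i) \/ f i = set0) /\
    forall U, B U -> exists2 i, i < k & f i = U}.
  apply: cid; have [/(enum_of_card_le set0)[f fP]|] := pselect (B #<= `I_k).
    by exists f.
  by exists (fun=> set0).
have ref_small r : (forall A, A \in r -> open_cover A) -> small_position (map ref r).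
  move=> rcov _ /mapP[A /rcov Acov ->]; split.
    exact: open_cover_common_refinement.
  by move=> O [].
have en_ref r : r <> [::] -> (forall A, A \in r -> open_cover A) ->
    sigma (s ++ map ref r) #<= `I_k.
  by move=> r0 rcov; apply: bound; [case: r r0 {rcov} | exact: ref_small].
exists k, (fun r => sval (en (sigma (s ++ map ref r)))); split.
  move=> r A rcov Acov i ik.
  have racov A' : A' \in rcons r A -> open_cover A'.
    by rewrite mem_rcons inE => /predU1P[->//|]; exact: rcov.
  have r0 : rcons r A <> [::] by case: (r).
  have [+ _] := svalP (en (sigma (s ++ map ref (rcons r A)))) (en_ref _ r0 racov).
  move=> /(_ i ik)[|->]; last first.
    have [U AU _] : (\bigcup_(U in A) U) x0 by rewrite Acov.2.
    by exists U.
  set f := sval _; rewrite map_rcons -rcons_cat => ans.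
  have [||_ /(_ _ ans)[]//] := @answer_legal (s ++ map ref r) (ref A).
    by move=> A'; rewrite mem_cat => /orP[/ss[]//|/(ref_small _ rcov)[]].
  exact: open_cover_common_refinement.
move=> A Acov x xs.
(* The play of the bounded game that starts with [s]. *)
pose A' n := if n < size s then nth set0 s n else ref (A (n - size s)).
have A'cov n : open_cover (A' n).
  rewrite /A'; case: ifPn => [lt|_]; last exact: open_cover_common_refinement.
  by have [] := ss _ (mem_nth set0 lt).
have A'early n : n < size s -> mkseq A' n.+1 = take n.+1 s.
  move=> lt; apply: (@eq_from_nth _ set0); rewrite size_mkseq ?size_takel//.
  move=> i ltin; rewrite nth_mkseq// nth_take// /A'.
  by rewrite (leq_ltn_trans _ lt).
have A'late n : mkseq A' (size s + n) = s ++ map ref (mkseq A n).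
  apply: (@eq_from_nth _ set0).
    by rewrite size_cat size_map !size_mkseq.
  move=> i; rewrite size_mkseq => lt; rewrite nth_mkseq// nth_cat /A'.
  case: ltnP => // ge; rewrite (nth_map set0) ?size_mkseq ?ltn_subLR// nth_mkseq//.
  by rewrite ltn_subLR.
have [ans [[_ cov] _]] := winning A'cov.
have [U [n _ Un] Ux] : (\bigcup_(U in \bigcup_n bob_answers sigma A' n) U) x.
  by rewrite cov.
have [lt|ge] := ltnP n (size s).
  by case: xs; exists n => //; exists U => //; rewrite -A'early.
have nE : n.+1 = size s + (n - size s).+1 by rewrite addnS subnKC.
move: Un; rewrite /bob_answers nE A'late => Un.
have [|_ /(_ _ Un)[i ik iU]] :=
    svalP (en (sigma (s ++ map ref (mkseq A (n - size s).+1)))).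
  by apply: en_ref => // A'' /mapP[m _ ->].
by exists (n - size s) => //; exists i => //; rewrite iU.
Qed.

End positions.

(** * Compactness of the set of uncoverable points *)

Lemma filter_closure_bigcup (X : topologicalType) (F : set_system X) (I : choiceType)
    (D : set I) (B : I -> set X) : Filter F -> finite_set D ->
  (forall i, D i -> F (~` closure (B i))) -> F (~` closure (\bigcup_(i in D) B i)).
Proof.
move=> FF finD FB; have /finite_fsetP[E DE] := finD.
have : F (\bigcap_(i in D) ~` closure (B i)).
  by rewrite DE; apply: filter_bigI => i iE; apply: FB; rewrite DE.
apply: filterS => x nx /(closure_bigcup_finite finD)[i Di].
exact: nx.
Qed.

Lemma boundedly_coverableS (X : topologicalType) (O O' : set X) :
  O `<=` O' -> boundedly_coverable O' -> boundedly_coverable O.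
Proof.
move=> OO' [k [tau [ref cov]]]; exists k, tau; split=> // A Acov.
exact: subset_trans OO' (cov A Acov).
Qed.

Definition uncoverable (X : topologicalType) : set X :=
  [set x | ~ exists O : set X, [/\ open O, O x & boundedly_coverable O]].

Arguments uncoverable X : clear implicits.

(** A filter on [uncoverable X] without cluster point there lets Alice restrict
    herself to open sets whose closure has its complement in the filter.  Finite
    unions of such sets inherit this property, so that at a bounded position some
    uncoverable point would be left in a boundedly coverable open set. *)
Lemma compact_uncoverable (X : topologicalType) :
  @regular_space X -> bob_wins_Gbnd X -> compact (uncoverable X).
Proof.
move=> regX [sigma win] F FF FK; apply: contrapT => /set0P/negP/negPn/eqP nocl.
have Wcov : open_cover [set O : set X | open O /\ F (~` closure O)].
  split=> [O []//|]; apply/seteqP; split=> // x _.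
  have [Kx|/contrapT[O [oO Ox bO]]] := pselect (uncoverable X x).
    have : ~ cluster F x by move=> cx; have : set0 x by rewrite -nocl.
    move=> /existsNP[G /existsNP[N /not_implyP[FG /not_implyP[Nx]]]].
    move=> /set0P/negP/negPn/eqP GN.
    have [M [oM Mx MN]] := regular_open_closure regX (open_interior N) Nx.
    exists M => //; split=> //; apply: filterS FG => y Gy /MN/interior_subset Ny.
    by have : set0 y by rewrite -GN.
  have [M [oM Mx MO]] := regular_open_closure regX oO Ox.
  exists M => //; split=> //; apply: filterS FK => y Ky /MO Oy.
  by apply: Ky; exists O.
have [s [k [ss bound]]] := bounded_position win [set O | open O /\ F (~` closure O)].
have Fs : F (~` closure (covered_at sigma s)).
  apply: filter_closure_bigcup => // n ns.
  have ncov A : A \in take n s -> open_cover A by move=> /mem_take/ss[].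
  have [snc snr] := ss _ (mem_nth set0 ns).
  have [fin sub] := answer_legal win ncov snc.
  rewrite -(take_nth set0 ns) in fin sub.
  apply: filter_closure_bigcup => // U /sub/snr[O [_ FO] UO].
  by apply: filterS FO => x xO /(closureS UO).
have [x [Kx xs]] := filter_ex (filterI FK Fs).
apply: Kx; exists (~` closure (covered_at sigma s)); split=> //.
  by rewrite openC; exact: closed_closure.
apply: boundedly_coverableS (boundedly_coverable_position win Wcov x ss bound).
by move=> y ny /subset_closure.
Qed.

(** * The strategy given by a compact set *)

Lemma compact_finite_subcover (X : topologicalType) (K : set X) (A : set (set X)) :
  compact K -> open_cover A ->
  exists B, [/\ finite_set B, B `<=` A & K `<=` \bigcup_(U in B) U].
Proof.
move=> /compact_near_coveringP cK [oA covA].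
(* The finite subfamilies of [A], directed by inclusion. *)
pose F : set_system (set (set X)) := [set P | exists2 B, finite_set B /\ B `<=` A &
  forall B', finite_set B' -> B' `<=` A -> B `<=` B' -> P B'].
have FF : Filter F.
  split.
  - by exists set0 => //; split=> //; exact: sub0set.
  - move=> P Q [B [fB BA] BP] [C [fC CA] CQ]; exists (B `|` C).
      by split; [rewrite finite_setU | rewrite subUset].
    by move=> B' fB' B'A; rewrite subUset => -[BB' CB']; split; [exact: BP|exact: CQ].
  - move=> P Q PQ [B fBA BP]; exists B => // B' fB' B'A BB'.
    by apply: PQ; exact: BP.
have [|B [fB BA] /(_ B fB BA (@subset_refl _ B)) KB] :=
    cK _ F (fun B x => (\bigcup_(U in B) U) x) FF.
  move=> x Kx; have [U AU Ux] : (\bigcup_(U in A) U) x by rewrite covA.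
  exists (U, [set B | B U]) => /=.
    split; first by apply: open_nbhs_nbhs; split => //; exact: oA.
    exists [set U]; first by split; [exact: finite_set1 | move=> _ ->].
    by move=> B' _ _; apply.
  by move=> [y B] /= [Uy BU]; exists U.
by exists B.
Qed.

(** Inning [0] covers [K]; the one-set game on the rest is played on traces of
    Alice's later covers, so inning [n] of that game is inning [n.+1] here, and its
    answers are lifted back to members of those covers. *)
Lemma bob_wins_Gbnd_of_compact (X : topologicalType) (K : set X) : compact K ->
  (forall V, open V -> K `<=` V -> bob_wins_G1 (set_type (~` V))) ->
  bob_wins_Gbnd X.
Proof.
move=> cK win.
have sub (A : set (set X)) : {B | open_cover A ->
    [/\ finite_set B, B `<=` A & K `<=` \bigcup_(U in B) U]}.
  apply: cid; have [Acov|] := pselect (open_cover A); last by exists set0.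
  by have [B] := compact_finite_subcover cK Acov; exists B.
pose B0 A := sval (sub A); pose V A := \bigcup_(U in B0 A) U.
have V_open A : open_cover A -> open (V A).
  move=> Acov; have [_ BA _] := svalP (sub A) Acov.
  by apply: bigcup_open => U /BA; exact: Acov.1.
have strat (A : set (set X)) : {tau : bob_strategy (set_type (~` V A)) |
    open_cover A -> winning_for_bob (@won_G1 _) tau}.
  apply: cid; have [Acov|] := pselect (open_cover A); last by exists (fun=> set0).
  have [_ _ KV] := svalP (sub A) Acov.
  by have [tau] := win (V A) (V_open A Acov) KV; exists tau.
pose tr A0 (A : set (set X)) : set (set (set_type (~` V A0))) :=
  [set set_val @^-1` U | U in A].
pose lift A0 A (u : set (set_type (~` V A0))) : set X :=
  xget set0 [set U | A U /\ set_val @^-1` U = u].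
have liftP A0 A u : tr A0 A u -> A (lift A0 A u) /\ set_val @^-1` (lift A0 A u) = u.
  by move=> [U AU Uu]; rewrite /lift; case: xgetP => [U' _ []//|/(_ U)[]].
pose sigma (l : seq (set (set X))) : set (set X) :=
  if l is A0 :: l' then
    if l' is [::] then B0 A0
    else lift A0 (last A0 l') @` sval (strat A0) (map (tr A0) l')
  else set0.
exists sigma => A Acov; set A0 := A 0; pose T n := tr A0 (A n.+1).
have ans0 : bob_answers sigma A 0 = B0 A0 by [].
have ansS n : bob_answers sigma A n.+1 =
    lift A0 (A n.+1) @` bob_answers (sval (strat A0)) T n.
  rewrite /bob_answers; have -> : mkseq A n.+2 = A0 :: mkseq (A \o S) n.+1.
    by rewrite /mkseq /= -[2]/(1 + 1) iotaDl -map_comp.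
  have -> : mkseq T n.+1 = map (tr A0) (mkseq (A \o S) n.+1).
    by rewrite /mkseq -map_comp.
  have -> : A n.+1 = last A0 (mkseq (A \o S) n.+1) by rewrite mkseqS last_rcons.
  by [].
have Tcov n : open_cover (T n).
  have [oA covA] := Acov n.+1; split=> [_ [U AU <-]|]; first by exists U => //; exact: oA.
  apply/seteqP; split=> // y _.
  have [U AU Uy] : (\bigcup_(U in A n.+1) U) (set_val y) by rewrite covA.
  by exists (set_val @^-1` U) => //; exists U.
have [finB BA _] := svalP (sub A0) (Acov 0).
have [ansT [oneT [_ covT]]] := svalP (strat A0) (Acov 0) T Tcov.
have legal n : finite_set (bob_answers sigma A n) /\ bob_answers sigma A n `<=` A n.
  case: n => [//|n]; rewrite ansS; have [finT subT] := ansT n; split.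
    exact: finite_image.
  by move=> _ [u /subT Tu <-]; have [] := liftP _ _ _ Tu.
split=> //; split; first split.
- by move=> U [n _ /(legal n).2]; exact: (Acov n).1.
- apply/seteqP; split=> // x _.
  have [[U BU Ux]|Vx] := pselect (V A0 x); first by exists U => //; exists 0.
  pose y : set_type (~` V A0) := SigSub (mem_set (Vx : (~` V A0) x)).
  have [u [n _ un] uy] : (\bigcup_(u in \bigcup_n bob_answers (sval (strat A0)) T n) u) y.
    by rewrite covT.
  exists (lift A0 (A n.+1) u); first by exists n.+1 => //; rewrite ansS; exists u.
  have [_ luE] := liftP _ _ _ ((ansT n).2 _ un).
  by move: uy; rewrite -{1}luE.
have [m Bm] := finB; exists (maxn m 1) => -[|n].
  rewrite ans0; apply: (@card_le_trans _ _ _ `I_m).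
    by move: Bm; rewrite card_eq_le => /andP[].
  by rewrite card_le_II leq_maxl.
rewrite ansS; apply: card_le_trans (card_image_le _ _) _.
by apply: card_le_trans (oneT n) _; rewrite card_le_II leq_maxr.
Qed.

(** * The characterization *)

(* [set_type (~` V)] carries the subspace topology (subtype_topology.v). *)
Theorem theorem4p18 (X : topologicalType) (regX : @regular_space X) :
  bob_wins_Gbnd X <->
  exists K : set X, compact K /\
    forall V : set X, open V -> K `<=` V -> bob_wins_G1 (set_type (~` V)).
Proof.
split=> [win|[K [cK win]]]; last exact: bob_wins_Gbnd_of_compact win.
exists (uncoverable X); split; first exact: compact_uncoverable.
move=> V oV KV; apply: bob_wins_G1_of_locally_boundedly_coverable => //.
  exact: lindelof_of_bob_wins_Gbnd.
by move=> x Vx; apply: contrapT => /KV.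
Qed.
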